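(* Let $X$ be a second-countable, locally compact (Hausdorff), locally non-discrete space. Then for every singular transmissible parameter $\mathfrak{G}$, the set of all metrics $d\in \mathrm{Met}(X)$ for which $(X,d)$ satisfies the local anti-$\mathfrak{G}$-transmissible property is a dense $G_\delta$ subset of $\mathrm{Met}(X)$.
   Context: A space is locally non-discrete if every non-empty open subset is non-discrete in the subspace topology (equivalently, it has no isolated points). For a metrizable space $X$, $\mathrm{Met}(X)$ denotes the set of all metrics on $X$ generating the topology of $X$, equipped with the topology generated by the $[0,\infty]$-valued metric $\mathcal{D}_X(d,e)=\sup_{(x,y)\in X^2}|d(x,y)-e(x,y)|$. Let $\mathbb{N}$ be the set of positive integers, $\mathcal{P}^*(\mathbb{N})$ the set of all non-empty subsets of $\mathbb{N}$, and for a topological space $T$ let $\mathcal{F}(T)$ be the set of all closed subsets of $T$. For $W\in\mathcal{P}^*(\mathbb{N})$ and a set $S$, $\mathrm{Seq}(W,S)$ is the set of all finite injective sequences $\{a_i\}_{i=1}^n$ in $S$ with $n\in W$. Transmissible parameter: a sextuple $\mathfrak{G}=(Q,P,F,G,Z,\phi)$ where $Q$ is an at most countable set, $P$ is a topological space, $F:Q\to\mathcal{F}(P)$ and $G:Q\to\mathcal{P}^*(\mathbb{N})$ are maps, $Z$ is a set, and $\phi$ assigns to each pair $(q,X)$ of $q\in Q$ and a metrizable space $X$ a map $\phi^{q,X}:\mathrm{Seq}(G(q),X)\times Z\times\mathrm{Met}(X)\to P$, such that for every metrizable space $X$, every $q\in Q$ and every $z\in Z$: (TP1) for every $a\in\mathrm{Seq}(G(q),X)$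 the map $\mathrm{Met}(X)\to P$, $d\mapsto\phi^{q,X}(a,z,d)$, is continuous; (TP2) for every $d\in\mathrm{Met}(X)$, if $S\subset X$ and $a\in\mathrm{Seq}(G(q),S)$, then $\phi^{q,X}(a,z,d)=\phi^{q,S}(a,z,d|_{S^2})$. A metric space $(X,d)$ satisfies the anti-$\mathfrak{G}$-transmissible property if for every $q\in Q$ there exist $a\in\mathrm{Seq}(G(q),X)$ and $z\in Z$ with $\phi^{q,X}(a,z,d)\in P\setminus F(q)$. For a property of metric spaces, $(X,d)$ satisfies the local property if every non-empty open metric subspace of $(X,d)$ satisfies the property; thus the local anti-$\mathfrak{G}$-transmissible property means that every non-empty open metric subspace satisfies the anti-$\mathfrak{G}$-transmissible property. $\mathfrak{G}$ is singular if for each $q\in Q$ and every $\epsilon\in(0,\infty)$ there exist $z\in Z$ and a finite metric space $(L,d_L)$ such that (1) the diameter of $(L,d_L)$ is at most $\epsilon$; (2) $\mathrm{card}(L)\in G(q)$; (3) $\phi^{q,L}(L,z,d_L)\in P\setminus F(q)$, where $L$ in the first argument means the points of $L$ arranged in some injective sequence of length $\mathrm{card}(L)$.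
   Formalization: In (TP2) the map φ is required to be compatible with all isometric embeddings, not only inclusions S ⊂ X, so that φ is invariant under isometry; without this the claim fails (let φ test whether the point a_1 equals a fixed object p not in X). *)

(* Defs.v *)
From HB Require Import structures.
From mathcomp Require Import all_boot all_order all_algebra finmap.
From mathcomp Require Import all_classical all_reals all_analysis.

Set Implicit Arguments.
Unset Strict Implicit.
Unset Printing Implicit Defensive.

Import Order.TTheory GRing.Theory Num.Theory.
Import numFieldNormedType.Exports.

Local Open Scope classical_set_scope.
Local Open Scope ring_scope.

(* [A : set X], used as a type, is the subtype {x | x \in A}, which the library
   equips with the subspace topology. *)
Definition locally_nondiscrete (X : topologicalType) : Prop :=
  forall U : set X, open U -> U !=set0 -> ~ (forall V : set U, open V).

(* Met(X). It is empty when X is not metrizable, so quantifying over all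
   topological spaces X and all d in Met(X) amounts to quantifying over
   metrizable X. *)
Record met (R : realType) (X : topologicalType) := Met {
  met_dist :> X -> X -> R;
  met_eq0 : forall x y, met_dist x y = 0 <-> x = y;
  met_sym : forall x y, met_dist x y = met_dist y x;
  met_triangle : forall x y z,
    met_dist x z <= met_dist x y + met_dist y z;
  met_nbhs : forall x,
    nbhs x = filter_from [set r | 0 < r] (fun r => [set y | met_dist x y < r])
}.

HB.instance Definition _ (R : realType) (X : topologicalType) :=
  gen_eqMixin (met R X).
HB.instance Definition _ (R : realType) (X : topologicalType) :=
  gen_choiceMixin (met R X).

Section MetTopology.
Context (R : realType) (X : topologicalType).
Implicit Types d e f : met R X.

(* [maxe 0] only matters for empty X, where the library's supremum of the
   empty set is -oo rather than 0. *)
Definition sup_dist d e : \bar R :=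
  maxe 0%E (ereal_sup (range (fun p : X * X => `|d p.1 p.2 - e p.1 p.2|%:E))).

Definition met_ball d (r : R) : set (met R X) :=
  [set e | (sup_dist d e < r%:E)%E].

Lemma sup_dist_ub d e x y : (`|d x y - e x y|%:E <= sup_dist d e)%E.
Proof.
by rewrite le_max; apply/orP; right; apply: ereal_sup_ubound; exists (x, y).
Qed.

Lemma sup_dist_le d e (c : \bar R) : (0 <= c)%E ->
  (forall x y, `|d x y - e x y|%:E <= c)%E -> (sup_dist d e <= c)%E.
Proof.
move=> c0 H; rewrite ge_max c0 /=.
by apply: ge_ereal_sup => _ [[x y] _ <-]; exact: H.
Qed.

Lemma met_ball_center d (r : R) : 0 < r -> met_ball d r d.
Proof.
move=> r0; apply: (@le_lt_trans _ _ 0%E); last by rewrite lte_fin.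
by apply: sup_dist_le => // x y; rewrite subrr normr0.
Qed.

Lemma met_ball_sym d e (r : R) : met_ball d r e -> met_ball e r d.
Proof.
apply: le_lt_trans; apply: sup_dist_le => [|x y]; first by rewrite le_max lexx.
by rewrite distrC; exact: sup_dist_ub.
Qed.

Lemma met_ball_triangle d e f (r s : R) :
  met_ball d r e -> met_ball e s f -> met_ball d (r + s) f.
Proof.
move=> de ef; apply: (le_lt_trans _ (lteD de ef)).
apply: sup_dist_le => [|x y]; first by rewrite adde_ge0// le_max lexx.
apply: le_trans (leeD (sup_dist_ub d e x y) (sup_dist_ub e f x y)).
by rewrite -EFinD lee_fin ler_distD.
Qed.

Let ent : set_system (met R X * met R X) := entourage_ met_ball.

HB.instance Definition _ := hasNbhs.Build (met R X) (nbhs_ ent).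
HB.instance Definition _ := @Nbhs_isPseudoMetric.Build R (met R X)
  ent erefl met_ball met_ball_center met_ball_sym met_ball_triangle erefl.

End MetTopology.

Section Restriction.
Context (R : realType) (X : topologicalType) (d : met R X) (S : set X).

Let dS (x y : S) : R := d (set_val x) (set_val y).

Let dS_eq0 x y : dS x y = 0 <-> x = y.
Proof.
by rewrite /dS met_eq0; split=> [/val_inj|->].
Qed.

Let dS_sym x y : dS x y = dS y x.
Proof. exact: met_sym. Qed.

Let dS_triangle x y z : dS x z <= dS x y + dS y z.
Proof. exact: met_triangle. Qed.

Let dS_nbhs (x : S) :
  nbhs x = filter_from [set r | 0 < r] (fun r => [set y | dS x y < r]).
Proof.
apply/seteqP; split=> A.
- move=> [_ [[B oB <-] Bx BA]].
  have : nbhs (set_val x) B by apply: open_nbhs_nbhs.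
  rewrite (met_nbhs d) => -[r r0 rB]; exists r => // y xy.
  by apply: BA; exact: rB.
- move=> [r r0 rA].
  have xr : nbhs (set_val x) [set y | d (set_val x) y < r].
    by rewrite (met_nbhs d); exists r.
  apply: (@filterS S (nbhs x) _ _ _ _ (@initial_continuous S X set_val x _ xr)).
  exact: rA.
Qed.

Definition met_restrict : met R S := Met dS_eq0 dS_sym dS_triangle dS_nbhs.

End Restriction.

Definition met_diam (R : realType) (X : topologicalType) (d : met R X) :
  \bar R := ereal_sup (range (fun p : X * X => (d p.1 p.2)%:E)).

Record fin_inj_seq (W : set nat) (S : eqType) := FinInjSeq {
  fis_seq :> seq S;
  fis_uniq : uniq fis_seq;
  fis_size : W (size fis_seq)
}.

(* In [tp_restrict] the inclusion of a subspace S in X is an isometric embedding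
   i : (S, dS) -> (X, d), so that it includes invariance under isometry;
   [tp_restrict_subset] below is the case of an actual subset. Invariance is
   needed: [singular] speaks of abstract finite metric spaces L, which have to
   be compared with the finite subsets of X carrying an isometric metric. *)
Record transmissible (R : realType) := Transmissible {
  tp_Q : Type;
  tp_Q_countable : countable [set: tp_Q];
  tp_P : topologicalType;
  tp_F : tp_Q -> set tp_P;
  tp_F_closed : forall q, closed (tp_F q);
  tp_G : tp_Q -> set nat;
  tp_G_nonempty : forall q, tp_G q !=set0;
  tp_G_pos : forall q, tp_G q `<=` [set n | (0 < n)%N];
  tp_Z : Type;
  tp_phi : forall (q : tp_Q) (X : topologicalType),
    fin_inj_seq (tp_G q) X -> tp_Z -> met R X -> tp_P;
  tp_continuous : forall (q : tp_Q) (X : topologicalType)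
    (a : fin_inj_seq (tp_G q) X) (z : tp_Z), continuous (tp_phi a z);
  tp_restrict : forall (q : tp_Q) (X S : topologicalType) (d : met R X)
    (dS : met R S) (i : S -> X), (forall x y, d (i x) (i y) = dS x y) ->
    forall (a : fin_inj_seq (tp_G q) S) (b : fin_inj_seq (tp_G q) X)
      (z : tp_Z), b = map i a :> seq X -> tp_phi b z d = tp_phi a z dS
}.

Lemma tp_restrict_subset (R : realType) (T : transmissible R) (q : tp_Q T)
    (X : topologicalType) (d : met R X) (S : set X)
    (a : fin_inj_seq (tp_G q) S) (b : fin_inj_seq (tp_G q) X) (z : tp_Z T) :
  b = map set_val a :> seq X -> tp_phi b z d = tp_phi a z (met_restrict d S).
Proof. exact: tp_restrict. Qed.

Definition metric_property (R : realType) : Type :=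
  forall X : topologicalType, met R X -> Prop.

Definition local_property (R : realType) (Pr : metric_property R) :
    metric_property R :=
  fun X d => forall U : set X, open U -> U !=set0 -> Pr U (met_restrict d U).

Definition anti_transmissible (R : realType) (T : transmissible R) :
    metric_property R :=
  fun X d => forall q : tp_Q T,
    exists (a : fin_inj_seq (tp_G q) X) (z : tp_Z T), (~` tp_F q) (tp_phi a z d).

Definition singular (R : realType) (T : transmissible R) : Prop :=
  forall (q : tp_Q T) (eps : R), 0 < eps ->
  exists (z : tp_Z T) (L : topologicalType) (dL : met R L),
    [/\ finite_set [set: L],
        (met_diam dL <= eps%:E)%E,
        tp_G q #|` fset_set [set: L] |%fset &
        exists a : fin_inj_seq (tp_G q) L,
          size a = #|` fset_set [set: L] |%fset /\ (~` tp_F q) (tp_phi a z dL)].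

(* Main.v *)
Require Import Defs.
From mathcomp Require Import all_boot all_order all_algebra lra.
From mathcomp Require Import all_classical all_reals all_analysis borel_hierarchy.

Set Implicit Arguments.
Unset Strict Implicit.
Unset Printing Implicit Defensive.

Import Order.TTheory GRing.Theory Num.Theory.
Import numFieldNormedType.Exports.

Local Open Scope classical_set_scope.
Local Open Scope ring_scope.

(** Why the theorem holds.

    Fix a countable basis of X.  By (TP2), d has the local anti-transmissible
    property if and only if for every q in Q and every non-empty basic open set
    U some finite sequence of points of U is sent outside F(q)
    ([anti_transmissible_restrict], [escapesS]).  By (TP1) each of these
    countably many conditions is open in Met(X) ([open_escapes]), so the set is
    a G_delta.

    For density, the conditions are achieved one after the other by
    perturbations that only increase the metric.  Such a perturbation of d is
    the maximum of d and finitely many pseudometrics |f x - f y| with f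
    continuous and 0 <= f <= r; it stays within r of d and still generates the
    topology, since it is continuous and dominates d ([met_of_dominating],
    [met_max_seq]).  Singularity provides a finite metric space L of diameter
    at most r that is sent outside F(q).  Place the points of L injectively in
    a subset of U whose d-diameter is at most the least non-zero distance in L;
    non-empty open sets are infinite, so there is room.  If f_p is a continuous
    extension of dL(p, -) from the placed points, then the maximum of d and of
    the |f_p x - f_p y| induces dL on the placed points: this is the Kuratowski
    embedding of L ([dense_upwards_escapes]).

    Iterating with rapidly decreasing radii, chosen so as to remain in the open
    sets already reached, gives a nondecreasing uniformly convergent sequence of
    metrics.  Its limit is continuous and dominates the first metric, hence is
    again in Met(X) ([met_nondecreasing_limit]).  Monotonicity thus replaces the
    completeness that a Baire category argument would use
    ([dense_bigcap_dense_upwards]). *)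

(** * Increasing a metric within Met(X) *)

Section MetIncrease.
Context {R : realType} {X : topologicalType}.
Implicit Types d e : met R X.

Lemma met_refl d x : d x x = 0.
Proof. exact/met_eq0. Qed.

Lemma met_ge0 d x y : 0 <= d x y.
Proof.
have := met_triangle d x y x; rewrite met_refl (met_sym d y x); lra.
Qed.

Lemma met_gt0 d x y : x <> y -> 0 < d x y.
Proof.
move=> xy; rewrite lt_neqAle met_ge0 andbT eq_sym.
by apply/eqP => /met_eq0.
Qed.

Lemma near_met d x (r : R) : 0 < r -> \forall y \near x, d x y < r.
Proof.
by move=> r0; rewrite -[_ _]/(nbhs x _) (met_nbhs d); exists r.
Qed.

Lemma met_continuous d a : continuous (fun x => d x a : R^o).
Proof.
move=> x; apply/cvgrPdist_lt => r r0; near=> y.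
have : d x y < r by near: y; exact: near_met.
have := met_triangle d x y a; have := met_triangle d y x a.
rewrite (met_sym d y x) ltr_norml; lra.
Unshelve. all: by end_near. Qed.

(** The source of every new element of Met(X) below: domination makes the
    topology of e at least as fine as that of d, continuity makes it at most as
    fine, and domination also gives separation. *)
Lemma met_of_dominating d (e : X -> X -> R) :
  (forall x, e x x = 0) -> (forall x y, e x y = e y x) ->
  (forall x y z, e x z <= e x y + e y z) ->
  (forall x y, d x y <= e x y) ->
  (forall x (r : R), 0 < r -> \forall y \near x, e x y < r) ->
  exists e' : met R X, met_dist e' = e.
Proof.
move=> e0 esym etri de ects.
have eeq0 x y : e x y = 0 <-> x = y.
  split=> [exy|->//]; apply/(met_eq0 d)/le_anti.
  by rewrite met_ge0 andbT -exy.
suff enbhs x :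
    nbhs x = filter_from [set r | 0 < r] (fun r => [set y | e x y < r]).
  by exists (Met eeq0 esym etri enbhs).
apply/seteqP; split=> A.
  rewrite (met_nbhs d) => -[r r0 rA]; exists r => // y /= exy.
  exact/rA/(le_lt_trans (de x y)).
by move=> [r r0 rA]; apply: filterS (ects x r r0); exact: rA.
Qed.

Lemma met_max d (f : X -> R^o) : continuous f ->
  exists e, forall x y, e x y = Num.max (d x y) `|f x - f y|.
Proof.
move=> fcts.
pose e x y := Num.max (d x y) `|f x - f y|.
suff [e' e'E] : exists e' : met R X, met_dist e' = e.
  by exists e' => x y; rewrite e'E.
apply: (@met_of_dominating d) => [x|x y|x y z|x y|x r r0]; rewrite /e.
- by rewrite met_refl subrr normr0 maxxx.
- by rewrite met_sym distrC.
- rewrite ge_max; apply/andP; split.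
    apply: le_trans (met_triangle d x y z) _.
    by apply: lerD; rewrite le_max lexx.
  apply: le_trans (ler_distD (f y) _ _) _.
  by apply: lerD; rewrite le_max lexx orbT.
- by rewrite le_max lexx.
- near=> y; rewrite gt_max; apply/andP; split; near: y.
    exact: near_met.
  by have /cvgrPdist_lt := fcts x; exact.
Unshelve. all: by end_near. Qed.

(** The maximum is given by its universal property, which yields at once the
    lower bounds on e and the upper bounds that control the perturbation. *)
Lemma met_max_seq d (I : eqType) (s : seq I) (f : I -> X -> R^o) :
  (forall i, i \in s -> continuous (f i)) ->
  exists e, forall x y (c : R), e x y <= c <->
    d x y <= c /\ forall i, i \in s -> `|f i x - f i y| <= c.
Proof.
elim: s => [|i s IH] fcts; first by exists d => x y c; split=> [|[]].
have [|e eP] := IH; first by move=> j js; apply: fcts; rewrite inE js orbT.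
have [e' e'E] := @met_max e (f i) (fcts i (mem_head i s)).
exists e' => x y c; rewrite e'E ge_max; split.
  move=> /andP[/eP[dc fc] fi]; split=> // j; rewrite inE => /predU1P[->//|].
  exact: fc.
move=> [dc fc]; apply/andP; split; last by apply: fc; exact: mem_head.
by apply/eP; split=> // j js; apply: fc; rewrite inE js orbT.
Qed.

(** A uniform limit of metrics in Met(X) may fail to separate points or generate
    a coarser topology; a nondecreasing one stays above [d 0], which excludes
    both.  The hypothesis bounds the k-th increment by [r k - r k.+1] so that
    the increments telescope. *)
Lemma met_nondecreasing_limit (d : nat -> met R X) (r : nat -> R) :
  (forall k x y, d k x y <= d k.+1 x y) ->
  (forall k x y, d k.+1 x y <= d k x y + (r k - r k.+1)) ->
  (forall k, 0 <= r k) ->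
  (forall eps : R, 0 < eps -> exists k, r k < eps) ->
  exists e, forall k x y, d k x y <= e x y <= d k x y + r k.
Proof.
move=> dS dr r0 rlim.
have dD k m x y : d k x y <= d (k + m)%N x y <= d k x y + (r k - r (k + m)%N).
  elim: m => [|m /andP[IH1 IH2]]; first by rewrite addn0 subrr addr0 lexx.
  rewrite addnS; have := dS (k + m)%N x y; have := dr (k + m)%N x y; lra.
have dle k m x y : d m x y <= d k x y + r k.
  have [km|/ltnW mk] := leqP k m.
    have /andP[_] := dD k (m - k)%N x y; rewrite subnKC//.
    have := r0 m; lra.
  have /andP[+ _] := dD m (k - m)%N x y; rewrite subnKC//.
  have := r0 k; lra.
pose e x y := sup (range (fun k => d k x y)).
have esup x y : has_sup (range (fun k => d k x y)).
  split; first by exists (d 0 x y); exists 0%N.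
  by exists (d 0 x y + r 0%N) => _ [m _ <-]; exact: dle.
have le_e k x y : d k x y <= e x y.
  by apply: sup_upper_bound => //; exists k.
have e_le x y (c : R) : (forall k, d k x y <= c) -> e x y <= c.
  move=> dc; apply: ge_sup; first by case: (esup x y).
  by move=> _ [k _ <-].
suff [e' e'E] : exists e' : met R X, met_dist e' = e.
  exists e' => k x y; rewrite e'E le_e/=.
  by apply: e_le => m; exact: dle.
apply: (@met_of_dominating (d 0)) => [x|x y|x y z|x y|x eps eps0].
- apply/le_anti; rewrite -{2}(met_refl (d 0) x) le_e andbT.
  by apply: e_le => k; rewrite met_refl.
- by rewrite /e; congr sup; apply: eq_imagel => k _; exact: met_sym.
- apply: e_le => k; apply: le_trans (met_triangle (d k) x y z) _.
  by apply: lerD; exact: le_e.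
- exact: le_e.
- have [|k rk] := rlim (eps / 2); first lra.
  have : \forall y \near x, d k x y < eps / 2 by apply: near_met; lra.
  apply: filterS => y dxy; apply: (@le_lt_trans _ _ (d k x y + r k)); last lra.
  by apply: e_le => m; exact: dle.
Qed.

End MetIncrease.

(** * Countable intersections of open sets reached by increasing the metric *)

Lemma lt_geometric (R : realType) (a b : R) : 0 < b -> exists k, a / 2 ^+ k < b.
Proof.
move=> b0; exists (Num.bound (a / b)).
rewrite ltr_pdivrMr ?exprn_gt0// mulrC -ltr_pdivrMr//.
exact: upper_nthrootP.
Qed.

Section DenseUpwards.
Context {R : realType} {X : topologicalType}.
Implicit Types d e : met R X.

Lemma open_met_closed_ball (O : set (met R X)) d : open O -> O d ->
  exists2 r : R, 0 < r &
    forall e, (forall x y, `|d x y - e x y| <= r) -> O e.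
Proof.
move=> oO Od; have /nbhs_ballP[r /= r0 rO] : nbhs d O by exact: open_nbhs_nbhs.
exists (r / 2) => [|e de]; first by rewrite divr_gt0.
apply: rO; apply: (@le_lt_trans _ _ (r / 2)%:E); last by rewrite lte_fin; lra.
by apply: sup_dist_le => [|x y]; rewrite lee_fin//; lra.
Qed.

Definition dense_upwards (O : set (met R X)) :=
  forall d (r : R), 0 < r ->
    exists2 e, O e & forall x y, d x y <= e x y <= d x y + r.

(** A Baire category argument in which convergence comes from monotonicity
    rather than from completeness: the approximations increase, so that
    [met_nondecreasing_limit] applies whatever X is. *)
Lemma dense_bigcap_dense_upwards (O : nat -> set (met R X)) :
  (forall k, open (O k)) -> (forall k, dense_upwards (O k)) ->
  dense (\bigcap_k O k).
Proof.
move=> oO upO W [d0 Wd0] oW.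
have [r0 r0_gt0 r0W] := open_met_closed_ball oW Wd0.
(* The state is a metric with a radius whose closed ball must contain the final
   limit.  The metric uses up at most half of the current radius, and the other
   half bounds the next radius. *)
pose step k (p p' : met R X * R) := 0 < p.2 ->
  [/\ 0 < p'.2, p'.2 <= p.2 / 2,
      forall x y, p.1 x y <= p'.1 x y <= p.1 x y + p.2 / 2 &
      forall e, (forall x y, `|p'.1 x y - e x y| <= p'.2) -> O k e].
have /choice[next nextP] : forall kp : nat * (met R X * R),
    exists p', step kp.1 kp.2 p'.
  move=> [k [d r]] /=; have [r_gt0|r_le0] := ltP 0 r; last first.
    by exists (d, r) => /=; rewrite /step/= ltNge r_le0.
  have [|e Oe de] := upO k d (r / 2); first by rewrite divr_gt0.
  have [s s0 sO] := open_met_closed_ball (oO k) Oe.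
  exists (e, Num.min s (r / 2)) => _; split => //=.
  - by rewrite lt_min s0 divr_gt0.
  - by rewrite ge_min lexx orbT.
  - move=> e' e'P; apply: sO => x y; apply: le_trans (e'P x y) _.
    by rewrite ge_min lexx.
pose p := fix p k := if k is k'.+1 then next (k', p k') else (d0, r0).
have p_gt0 k : 0 < (p k).2.
  by elim: k => //= k IH; have [] := nextP (k, p k) IH.
have pS k : step k (p k) (p k.+1) by exact: (nextP (k, p k)).
have p_geo k : (p k).2 <= r0 / 2 ^+ k.
  elim: k => [|k IH]; first by rewrite expr0 divr1.
  have [_ + _ _] := pS k (p_gt0 k) => /le_trans; apply.
  by rewrite exprSr invfM mulrA ler_pM2r// invr_gt0.
have [e eP] : exists e, forall k x y,
    (p k).1 x y <= e x y <= (p k).1 x y + (p k).2.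
  apply: met_nondecreasing_limit.
  - by move=> k x y; have [_ _ /(_ x y)/andP[]] := pS k (p_gt0 k).
  - move=> k x y; have [_ h /(_ x y)/andP[_ +] _] := pS k (p_gt0 k).
    lra.
  - by move=> k; exact: ltW.
  - move=> eps eps0; have [k kP] := lt_geometric r0 eps0.
    by exists k; apply: le_lt_trans kP.
have eball k x y : `|(p k).1 x y - e x y| <= (p k).2.
  have := eP k x y; have := p_gt0 k; rewrite ler_norml; lra.
exists e; split; first by apply: r0W; exact: eball 0%N.
by move=> k _; have [_ _ _] := pS k (p_gt0 k); apply; exact: eball.
Qed.

End DenseUpwards.

(** * Continuous interpolation at finitely many points *)

Lemma seq_pos_lower_bound (R : realType) (I : eqType) (s : seq I) (f : I -> R) :
  (forall i, i \in s -> 0 < f i) ->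
  exists2 m : R, 0 < m & forall i, i \in s -> m <= f i.
Proof.
elim: s => [|i s IH] f0; first by exists 1.
have [|m m0 mf] := IH; first by move=> j js; apply: f0; rewrite inE js orbT.
exists (Num.min (f i) m) => [|j].
  by rewrite lt_min m0 f0// mem_head.
rewrite inE ge_min => /predU1P[->|/mf ->]; first by rewrite lexx.
by rewrite orbT.
Qed.

Section Interpolation.
Context {R : realType} {X : topologicalType}.
Implicit Types d : met R X.

Lemma bump_function d a (s : seq X) : a \notin s ->
  exists h : X -> R^o, [/\ continuous h, forall x, 0 <= h x <= 1, h a = 1 &
    forall x, x \in s -> h x = 0].
Proof.
move=> as_; have [x xs|m m0 md] := @seq_pos_lower_bound R _ s (fun x => d x a).
  by apply: met_gt0 => xa; rewrite -xa xs in as_.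
exists (fun x => Num.max 0 (1 - d x a / m)); split.
- move=> x.
  apply: (@continuous_max R X (fun=> 0) (fun y => 1 - d y a / m)).
    exact: cvg_cst.
  apply: cvgB; first exact: cvg_cst.
  apply: cvgM; last exact: cvg_cst.
  exact: met_continuous.
- move=> x; rewrite le_max lexx/= ge_max ler01/=.
  by rewrite gerBl divr_ge0// ?met_ge0// ltW.
- by rewrite met_refl mul0r subr0; apply/max_idPr.
- move=> x xs; apply/max_idPl; rewrite subr_le0 ler_pdivlMr// mul1r.
  exact: md.
Qed.

(** One point is added at a time: a bump function at the new point moves the
    value there along a segment, which keeps it between 0 and c. *)
Lemma finite_interpolation d (I : eqType) (s : seq I) (i : I -> X)
    (g : I -> R) (c : R) : 0 <= c -> {in s &, injective i} ->
  (forall p, p \in s -> 0 <= g p <= c) ->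
  exists f : X -> R^o, [/\ continuous f, forall x, 0 <= f x <= c &
    forall p, p \in s -> f (i p) = g p].
Proof.
move=> c0; elim: s => [|p s IH] iinj gc.
  exists (fun=> 0); split=> // x; last by rewrite lexx.
  exact: cvg_cst.
have [||f [fcts fc fg]] := IH.
- by move=> q q' qs q's; apply: iinj; rewrite inE ?qs ?q's orbT.
- by move=> q qs; apply: gc; rewrite inE qs orbT.
have [ps|ps] := boolP (p \in s).
  by exists f; split=> // q; rewrite inE => /predU1P[->|]; exact: fg.
have [|h [hcts h01 hp hs]] := @bump_function d (i p) (map i s).
  apply/mapP => -[q qs /iinj]; rewrite !inE eqxx qs orbT => /(_ isT isT) pq.
  by rewrite pq qs in ps.
exists (fun x => f x + h x * (g p - f x)); split.
- move=> x; apply: cvgD; first exact: fcts.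
  apply: cvgM; first exact: hcts.
  by apply: cvgB; [exact: cvg_cst|exact: fcts].
- move=> x; have := h01 x; have := fc x; have := gc p (mem_head p s).
  by move=> /andP[? ?] /andP[? ?] /andP[? ?]; apply/andP; split; nra.
- move=> q; rewrite inE => /predU1P[->|qs]; first by rewrite hp; lra.
  by rewrite hs ?map_f// mul0r addr0 fg.
Qed.

End Interpolation.

(** * Room for finite sets in open sets *)

Lemma exists_inj_finite_infinite (L Y : Type) (V : set Y) :
  finite_set [set: L] -> infinite_set V ->
  exists2 i : L -> Y, injective i & forall p, V (i p).
Proof.
move=> finL /infiniteP infV.
have /card_leP[f] := card_le_trans (finite_set_countable finL) infV.
pose inc (p : L) : [set: L] := SigSub (mem_set (I : [set: L] p)).
exists (fun p => set_val (f (inc p))) => [p q /val_inj fpq|p]; last first.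
  exact: set_valP.
have : inc p = inc q by apply: (@inj _ _ _ f); rewrite ?in_setT.
by move=> /(congr1 val).
Qed.

(** In a Hausdorff space a finite subspace is discrete. *)
Lemma infinite_open (X : topologicalType) (U : set X) : hausdorff_space X ->
  locally_nondiscrete X -> open U -> U !=set0 -> infinite_set U.
Proof.
move=> hX nd oU U0 finU; apply: (nd U oU U0) => V.
have fclosed := accessible_finite_set_closed.1 (hausdorff_accessible hX).
(* The points of U outside V form a finite, hence closed, set. *)
exists (~` (U `\` set_val @` V)).
  by apply: closed_openC; apply: fclosed; apply: finite_setD.
apply/seteqP; split=> x /=.
  move=> /not_andP[|/contrapT[y Vy /val_inj <-//]].
  by case; exact: set_valP.
by move=> Vx -[_]; apply; exists x.
Qed.

(** * The conditions defining the anti-transmissible property *)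

Section AntiTransmissible.
Context {R : realType} (T : transmissible R).

(** The parameter is evaluated in X rather than in the subspace U: all these
    conditions then live on the single space Met(X), where they are compared
    and intersected. *)
Definition escapes (X : topologicalType) (U : set X) (q : tp_Q T) :
    set (met R X) :=
  [set d | exists (a : fin_inj_seq (tp_G q) X) (z : tp_Z T),
    (forall x, x \in fis_seq a -> U x) /\ (~` tp_F q) (tp_phi a z d)].

Lemma open_escapes (X : topologicalType) (U : set X) (q : tp_Q T) :
  open (escapes U q).
Proof.
have -> : escapes U q = \bigcup_(a in [set a : fin_inj_seq (tp_G q) X |
    forall x, x \in fis_seq a -> U x]) \bigcup_z
      ((tp_phi a z) @^-1` (~` tp_F q)).
  apply/seteqP; split=> d.
    by move=> [a [z [aU az]]]; exists a => //; exists z.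
  by move=> [a aU [z _ az]]; exists a, z.
apply: bigcup_open => a _; apply: bigcup_open => z _.
have /continuousP := @tp_continuous R T q X a z; apply.
exact/closed_openC/tp_F_closed.
Qed.

Lemma escapesS (X : topologicalType) (U V : set X) (q : tp_Q T) :
  U `<=` V -> escapes U q `<=` escapes V q.
Proof. by move=> UV d [a [z [aU az]]]; exists a, z; split=> // x /aU/UV. Qed.

Lemma anti_transmissible_restrict (X : topologicalType) (d : met R X)
    (U : set X) :
  anti_transmissible T (met_restrict d U) <-> forall q, escapes U q d.
Proof.
split=> dU q.
  have [a [z az]] := dU q.
  have buniq : uniq (map set_val a).
    by rewrite map_inj_uniq ?fis_uniq//; exact: val_inj.
  have bsize : tp_G q (size (map set_val a)).
    by rewrite size_map; exact: fis_size.
  exists (FinInjSeq buniq bsize), z; split=> [x /mapP[y _ ->]|].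
    exact: set_valP.
  by rewrite (@tp_restrict_subset R T q X d U a).
have [b [z [bU bz]]] := dU q.
pose a : seq U := pmap insub b.
have ab : map set_val a = b.
  rewrite (pmap_filter (@insubK _ _ _)); apply/all_filterP/allP => x xb.
  by rewrite isSome_insub; exact/mem_set/bU.
have auniq : uniq a by apply: pmap_sub_uniq; exact: fis_uniq.
have asize : tp_G q (size a).
  by rewrite -(size_map set_val) ab; exact: fis_size.
exists (FinInjSeq auniq asize), z.
by rewrite -(@tp_restrict_subset R T q X d U _ b).
Qed.

(** The key step: an isometric copy of L is planted in U.  Its points are so
    close together that d does not exceed dL on them, so the maximum of d and of
    the pseudometrics |f_p x - f_p y| equals dL there: the triangle inequality
    of L bounds these pseudometrics by dL, and f_p itself attains dL(p, -). *)
Lemma dense_upwards_escapes (X : topologicalType) (U : set X) (q : tp_Q T) :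
  singular T -> (forall V : set X, open V -> V !=set0 -> infinite_set V) ->
  open U -> U !=set0 -> dense_upwards (escapes U q).
Proof.
move=> singT infV oU [x0 Ux0] d r r0.
have [z [L [dL [finL diamL _ [a [_ az]]]]]] := singT q r r0.
have dLr p p' : dL p p' <= r.
  rewrite -lee_fin; apply: le_trans diamL.
  by apply: ereal_sup_ubound; exists (p, p').
have /finite_seqP[s sE] := finL.
have sL p : p \in s by have : [set` s] p by rewrite -sE.
have [|m m0 mdL] := @seq_pos_lower_bound R _
    [seq pp <- [seq (p, p') | p <- s, p' <- s] | pp.1 != pp.2]
    (fun pp => dL pp.1 pp.2).
  by move=> pp; rewrite mem_filter => /andP[/eqP ? _]; exact: met_gt0.
have [B [oB Bx0 BU]] : exists B, [/\ open B, B x0 &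
    B `<=` U `&` [set y | d x0 y < m / 2]].
  have : nbhs x0 (U `&` [set y | d x0 y < m / 2]).
    apply: filterI; first exact: open_nbhs_nbhs.
    by apply: near_met; rewrite divr_gt0.
  by rewrite nbhsE => -[B [? ?] ?]; exists B.
have [|i iinj iB] := exists_inj_finite_infinite finL (infV B oB _).
  by exists x0.
have di p p' : d (i p) (i p') <= dL p p'.
  have [->|pp'] := eqVneq p p'; first by rewrite !met_refl.
  have := mdL (p, p'); rewrite mem_filter/= pp' /= allpairs_f ?sL// => /(_ isT).
  have [_ /= d1] := BU _ (iB p); have [_ /= d2] := BU _ (iB p').
  have := met_triangle d (i p) x0 (i p'); rewrite (met_sym d (i p) x0); lra.
(* The values dL p - lie in [0, r], so every |f_p x - f_p y| is at most r. *)
have /choice[f fP] : forall p, exists f : X -> R^o,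
    [/\ continuous f, forall x, 0 <= f x <= r & forall p', f (i p') = dL p p'].
  move=> p.
  have [|||f [fcts fr fE]] := @finite_interpolation R X d L s i (dL p) r.
  - exact: ltW.
  - by move=> ? ? _ _ /iinj.
  - by move=> p' _; rewrite met_ge0 dLr.
  - by exists f; split=> // p'; exact: fE.
have [|e eP] := @met_max_seq R X d L s f; first by move=> p _; case: (fP p).
have eiso p p' : e (i p) (i p') = dL p p'.
  have [_ _ fE] := fP p.
  apply/le_anti/andP; split.
    apply/eP; split=> // p'' _; have [_ _ gE] := fP p''; rewrite !gE.
    rewrite ler_norml.
    have := met_triangle dL p'' p p'; have := met_triangle dL p'' p' p.
    rewrite (met_sym dL p' p); lra.
  have /eP[_ /(_ p (sL p))] := lexx (e (i p) (i p')).
  rewrite !fE met_refl sub0r normrN; apply: le_trans; exact: ler_norm.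
exists e => [|x y].
  have buniq : uniq (map i a) by rewrite map_inj_uniq ?fis_uniq.
  have bsize : tp_G q (size (map i a)) by rewrite size_map; exact: fis_size.
  exists (FinInjSeq buniq bsize), z; split=> [x /mapP[p _ ->]|].
    by have [] := BU _ (iB p).
  by rewrite (tp_restrict eiso (a := a)).
apply/andP; split; first by have /eP[] := lexx (e x y).
apply/eP; split=> [|p _]; first lra.
have [_ fr _] := fP p.
have := fr x; have := fr y; have := met_ge0 d x y; rewrite ler_norml; lra.
Qed.

End AntiTransmissible.

Theorem theorem1p3 (R : realType) (X : topologicalType)
    (X_second_countable : @second_countable X)
    (X_locally_compact : locally_compact [set: X])
    (X_hausdorff : hausdorff_space X)
    (X_locally_nondiscrete : locally_nondiscrete X)
    (T : transmissible R) (T_singular : singular T) :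
  let A : set (met R X) :=
    [set d | local_property (anti_transmissible T) d] in
  dense A /\ Gdelta A.
Proof.
move=> A.
have infV V := @infinite_open X V X_hausdorff X_locally_nondiscrete.
have [B /countable_injP[cB cB_inj] [oB Bbasis]] := X_second_countable.
have /countable_injP[cQ cQ_inj] := tp_Q_countable T.
(* At most one condition is attached to each natural number; a number that codes
   no condition contributes the full space to the intersection. *)
pose codes k U q := [/\ B U, U !=set0 & pickle (cQ q, cB U) = k].
have codes_inj k U q U' q' : codes k U q -> codes k U' q' -> U = U' /\ q = q'.
  move=> [BU _ <-] [BU' _ /(pcan_inj pickleK)[qq' UU']].
  split; first by apply: cB_inj; rewrite ?inE.
  by apply: cQ_inj; rewrite ?in_setT.
pose F k : set (met R X) := [set d | forall U q, codes k U q -> escapes U q d].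
have FE k : F k = setT \/
    exists (U : set X) (q : tp_Q T), [/\ open U, U !=set0 & F k = escapes U q].
  have [[Uq Uqk]|noUq] :=
    pselect (exists Uq : set X * tp_Q T, codes k Uq.1 Uq.2).
    right; exists Uq.1, Uq.2; have [BU U0 _] := Uqk.
    split=> //; first exact: oB.
    apply/seteqP; split=> d; first by apply.
    by move=> dUq U q /(codes_inj _ _ _ _ _ Uqk) [<- <-].
  left; apply/seteqP; split=> // d _ U q Uqk.
  by case: noUq; exists (U, q).
have AE : A = \bigcap_k F k.
  apply/seteqP; split=> d.
    move=> dA k _ U q [BU U0 _].
    by apply/anti_transmissible_restrict: q; exact: dA (oB _ BU) U0.
  move=> dF U oU [x Ux]; apply/anti_transmissible_restrict => q.
  have [|V [BV Vx] VU] := Bbasis x U; first exact: open_nbhs_nbhs.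
  apply: (escapesS VU); apply: (dF (pickle (cQ q, cB V)) I).
  by split=> //; exists x.
have oF k : open (F k).
  by have [->|[U [q [_ _ ->]]]] := FE k; [exact: openT|exact: open_escapes].
split; last by exists F.
rewrite AE; apply: dense_bigcap_dense_upwards => // k.
have [->|[U [q [oU U0 ->]]]] := FE k; last exact: dense_upwards_escapes.
by move=> d r r0; exists d => // x y; rewrite lexx lerDl ltW.
Qed.
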